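(* Let $(A,\nwarrow,\nearrow,\alpha)$ be a real $3$-Hom-L-dendriform algebra and let $A_{\mathbb C}=A\otimes_{\mathbb R}\mathbb C$ be its complexification. Then $(A,\nwarrow,\nearrow,\alpha)$ has a complex structure if and only if $A_{\mathbb C}$ admits a decomposition (direct sum of complex vector spaces) $$A_{\mathbb C}=\mathfrak q\oplus\overline{\mathfrak q},$$ where $\mathfrak q$ is a complex subalgebra of $A_{\mathbb C}$.
   Context: Vector spaces are finite-dimensional over $\mathbb R$ or $\mathbb C$. A $3$-Hom-L-dendriform algebra is a tuple $(A,\nwarrow,\nearrow,\alpha)$ where $A$ is a vector space, $\nwarrow,\nearrow:\otimes^3A\to A$ and $\alpha:A\to A$ are linear, $\alpha$ is multiplicative (i.e. $\alpha(\nwarrow(x,y,z))=\nwarrow(\alpha(x),\alpha(y),\alpha(z))$ and likewise for $\nearrow$), and, writing $\{x,y,z\}^h=\nwarrow(x,y,z)+\nearrow(x,y,z)-\nearrow(y,x,z)$, $\{x,y,z\}^v=\nwarrow(x,y,z)+\nearrow(z,x,y)-\nearrow(z,y,x)$, $[x,y,z]^C=\{x,y,z\}^h+\{y,z,x\}^h+\{z,x,y\}^h$ (equal to the same cyclic sum of $\{\cdot,\cdot,\cdot\}^v$), the following hold for all $x_1,\dots,x_5\in A$ (where $\circlearrowleft_{1,2,3}$ is the sum over cyclic permutations of the indices $1,2,3$): (0) $\nwarrow(x_1,x_2,x_3)+\nwarrow(x_2,x_1,x_3)=0$; (1) $\nwarrow(\alpha(x_1),\alpha(x_2),\nwarrow(x_3,x_4,x_5))-\nwarrow(\alpha(x_3),\alpha(x_4),\nwarrow(x_1,x_2,x_5))=\nwarrow([x_1,x_2,x_3]^C,\alpha(x_4),\alpha(x_5))-\nwarrow([x_1,x_2,x_4]^C,\alpha(x_3),\alpha(x_5))$;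 (2) $\nwarrow(\alpha(x_1),\alpha(x_2),\nearrow(x_5,x_3,x_4))-\nearrow(\alpha(x_5),\alpha(x_3),\{x_1,x_2,x_4\}^h)=\nearrow(\alpha(x_5),[x_1,x_2,x_3]^C,\alpha(x_4))+\nearrow(\{x_1,x_2,x_5\}^v,\alpha(x_3),\alpha(x_4))$; (3) $\nearrow(\alpha(x_5),\alpha(x_1),\{x_2,x_3,x_4\}^h)-\nwarrow(\alpha(x_2),\alpha(x_3),\nearrow(x_5,x_1,x_4))=\nearrow(\{x_1,x_2,x_5\}^v,\alpha(x_3),\alpha(x_4))-\nearrow(\{x_1,x_3,x_5\}^v,\alpha(x_2),\alpha(x_4))$; (4) $\nwarrow([x_1,x_2,x_3]^C,\alpha(x_4),\alpha(x_5))=\circlearrowleft_{1,2,3}\nwarrow(\alpha(x_1),\alpha(x_2),\nwarrow(x_3,x_4,x_5))$; (5) $\nearrow(\alpha(x_5),[x_1,x_2,x_3]^C,\alpha(x_4))=\circlearrowleft_{1,2,3}\nwarrow(\alpha(x_1),\alpha(x_2),\nearrow(x_5,x_3,x_4))$; (6) $\nwarrow(\alpha(x_1),\alpha(x_2),\nearrow(x_5,x_3,x_4))+\nearrow(\alpha(x_5),\alpha(x_1),\{x_2,x_3,x_4\}^h)=\nearrow(\alpha(x_5),\alpha(x_2),\{x_1,x_3,x_4\}^h)+\nearrow(\{x_1,x_2,x_5\}^v,\alpha(x_3),\alpha(x_4))$. ''Real'' means over $\mathbb R$. The complexification $A_{\mathbb C}=\{x+iy\mid x,y\in A\}$ carries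 the $\mathbb C$-(multi)linear extensions of $\nwarrow,\nearrow,\alpha$. The conjugation is $\overline{x+iy}=x-iy$ for $x,y\in A$, and $\overline{\mathfrak q}=\{\overline X\mid X\in\mathfrak q\}$. A complex subalgebra of $A_{\mathbb C}$ is a complex linear subspace closed under the (extended) operations $\nwarrow,\nearrow$ and $\alpha$. A complex structure on $A$ is a linear map $J:A\to A$ with $J^2=-\mathrm{id}_A$ which is a Nijenhuis operator, i.e. $J\alpha=\alpha J$ and, for $\ast\in\{\nwarrow,\nearrow\}$ and all $x,y,z\in A$, $$\ast(Jx,Jy,Jz)=J\big(\ast(Jx,Jy,z)+\ast(Jx,y,Jz)+\ast(x,Jy,Jz)\big)-J^2\big(\ast(Jx,y,z)+\ast(x,Jy,z)+\ast(x,y,Jz)\big)+J^3\ast(x,y,z).$$ *)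

(* Defs.v *)
From HB Require Import structures.
From mathcomp Require Import all_boot all_order all_algebra.
From mathcomp Require Import reals complex.

Set Implicit Arguments.
Unset Strict Implicit.
Unset Printing Implicit Defensive.

Import GRing.Theory VectorInternalTheory.
Local Open Scope ring_scope.
Local Open Scope complex_scope.

(* A linear map V (x) V (x) V -> V, given as a trilinear function. *)
Record trilinear (K : fieldType) (V : lmodType K) := Trilinear {
  tri_fun :> V -> V -> V -> V;
  tri_linear1 : forall y z, linear (fun x => tri_fun x y z);
  tri_linear2 : forall x z, linear (fun y => tri_fun x y z);
  tri_linear3 : forall x y, linear (fun z => tri_fun x y z)
}.

Section HomLDendriform.

Variables (K : fieldType) (V : lmodType K).
Implicit Types (nw ne : V -> V -> V -> V) (alpha : V -> V).

(* The brackets {x,y,z}^h, {x,y,z}^v and [x,y,z]^C; in [cbr], the cyclic sum of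
   [hbr] is the same as that of [vbr]. *)
Definition hbr nw ne (x y z : V) : V := nw x y z + ne x y z - ne y x z.

Definition vbr nw ne (x y z : V) : V := nw x y z + ne z x y - ne z y x.

Definition cbr nw ne (x y z : V) : V :=
  hbr nw ne x y z + hbr nw ne y z x + hbr nw ne z x y.

Record is_hom_L_dendriform3 (nw ne : trilinear V) (alpha : {linear V -> V}) :
  Prop := IsHomLDendriform3 {
  hld_mult_nw : forall x y z,
    alpha (nw x y z) = nw (alpha x) (alpha y) (alpha z);
  hld_mult_ne : forall x y z,
    alpha (ne x y z) = ne (alpha x) (alpha y) (alpha z);
  hld_skew : forall x1 x2 x3, nw x1 x2 x3 + nw x2 x1 x3 = 0;
  hld_1 : forall x1 x2 x3 x4 x5,
    nw (alpha x1) (alpha x2) (nw x3 x4 x5)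
      - nw (alpha x3) (alpha x4) (nw x1 x2 x5)
    = nw (cbr nw ne x1 x2 x3) (alpha x4) (alpha x5)
      - nw (cbr nw ne x1 x2 x4) (alpha x3) (alpha x5);
  hld_2 : forall x1 x2 x3 x4 x5,
    nw (alpha x1) (alpha x2) (ne x5 x3 x4)
      - ne (alpha x5) (alpha x3) (hbr nw ne x1 x2 x4)
    = ne (alpha x5) (cbr nw ne x1 x2 x3) (alpha x4)
      + ne (vbr nw ne x1 x2 x5) (alpha x3) (alpha x4);
  hld_3 : forall x1 x2 x3 x4 x5,
    ne (alpha x5) (alpha x1) (hbr nw ne x2 x3 x4)
      - nw (alpha x2) (alpha x3) (ne x5 x1 x4)
    = ne (vbr nw ne x1 x2 x5) (alpha x3) (alpha x4)
      - ne (vbr nw ne x1 x3 x5) (alpha x2) (alpha x4);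
  hld_4 : forall x1 x2 x3 x4 x5,
    nw (cbr nw ne x1 x2 x3) (alpha x4) (alpha x5)
    = nw (alpha x1) (alpha x2) (nw x3 x4 x5)
      + nw (alpha x2) (alpha x3) (nw x1 x4 x5)
      + nw (alpha x3) (alpha x1) (nw x2 x4 x5);
  hld_5 : forall x1 x2 x3 x4 x5,
    ne (alpha x5) (cbr nw ne x1 x2 x3) (alpha x4)
    = nw (alpha x1) (alpha x2) (ne x5 x3 x4)
      + nw (alpha x2) (alpha x3) (ne x5 x1 x4)
      + nw (alpha x3) (alpha x1) (ne x5 x2 x4);
  hld_6 : forall x1 x2 x3 x4 x5,
    nw (alpha x1) (alpha x2) (ne x5 x3 x4)
      + ne (alpha x5) (alpha x1) (hbr nw ne x2 x3 x4)
    = ne (alpha x5) (alpha x2) (hbr nw ne x1 x3 x4)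
      + ne (vbr nw ne x1 x2 x5) (alpha x3) (alpha x4)
}.

Definition nijenhuis_identity (op : V -> V -> V -> V) (J : V -> V) : Prop :=
  forall x y z,
    op (J x) (J y) (J z)
    = J (op (J x) (J y) z + op (J x) y (J z) + op x (J y) (J z))
      - J (J (op (J x) y z + op x (J y) z + op x y (J z)))
      + J (J (J (op x y z))).

Record is_nijenhuis nw ne alpha (J : V -> V) : Prop := IsNijenhuis {
  nijenhuis_alpha : forall x, J (alpha x) = alpha (J x);
  nijenhuis_nw : nijenhuis_identity nw J;
  nijenhuis_ne : nijenhuis_identity ne J
}.

Record is_complex_structure nw ne alpha (J : {linear V -> V}) : Prop :=
  IsComplexStructure {
  complex_structure_sq : forall x, J (J x) = - x;
  complex_structure_nijenhuis : is_nijenhuis nw ne alpha J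
}.

End HomLDendriform.

Record is_subalgebra (K : fieldType) (V : vectType K)
    (nw ne : V -> V -> V -> V) (alpha : V -> V) (q : {vspace V}) : Prop :=
  IsSubalgebra {
  subalgebra_nw : {in q & &, forall x y z, nw x y z \in q};
  subalgebra_ne : {in q & &, forall x y z, ne x y z \in q};
  subalgebra_alpha : {in q, forall x, alpha x \in q}
}.

(* [Cplxf x y] stands for x + iy. *)
Record complexification (R : rcfType) (A : vectType R) : Type :=
  Cplxf { cre : A; cim : A }.

Section Complexification.

Variables (R : rcfType) (A : vectType R).
Notation AC := (complexification A).

Definition cplxf_pair (X : AC) : A * A := (cre X, cim X).
Definition pair_cplxf (p : A * A) : AC := Cplxf p.1 p.2.
Lemma cplxf_pairK : cancel cplxf_pair pair_cplxf. Proof. by case. Qed.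

HB.instance Definition _ := Choice.copy AC (can_type cplxf_pairK).

Lemma cplxfP (X Y : AC) : cre X = cre Y -> cim X = cim Y -> X = Y.
Proof. by case: X Y => [a b] [c d] /= -> ->. Qed.

Definition cplxf_zero : AC := Cplxf 0 0.
Definition cplxf_opp (X : AC) : AC := Cplxf (- cre X) (- cim X).
Definition cplxf_add (X Y : AC) : AC := Cplxf (cre X + cre Y) (cim X + cim Y).

Lemma cplxf_addA : associative cplxf_add.
Proof. by move=> X Y Z; apply: cplxfP; rewrite /= addrA. Qed.
Lemma cplxf_addC : commutative cplxf_add.
Proof. by move=> X Y; apply: cplxfP; rewrite /= addrC. Qed.
Lemma cplxf_add0 : left_id cplxf_zero cplxf_add.
Proof. by move=> X; apply: cplxfP; rewrite /= add0r. Qed.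
Lemma cplxf_addN : left_inverse cplxf_zero cplxf_opp cplxf_add.
Proof. by move=> X; apply: cplxfP; rewrite /= addNr. Qed.

HB.instance Definition _ := GRing.isZmodule.Build AC
  cplxf_addA cplxf_addC cplxf_add0 cplxf_addN.

Lemma creD (X Y : AC) : cre (X + Y) = cre X + cre Y. Proof. by []. Qed.
Lemma cimD (X Y : AC) : cim (X + Y) = cim X + cim Y. Proof. by []. Qed.

Definition cplxf_scale (c : R[i]) (X : AC) : AC :=
  Cplxf (Re c *: cre X - Im c *: cim X) (Im c *: cre X + Re c *: cim X).

Lemma cplxf_scaleA c d X :
  cplxf_scale c (cplxf_scale d X) = cplxf_scale (c * d) X.
Proof.
case: c d => [a b] [c d]; apply: cplxfP;
  rewrite /= !(scalerDr, scalerDl, scalerN, scaleNr, scalerBr, scalerBl).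
- by rewrite !scalerA !opprD addrACA.
- rewrite !scalerA addrACA; congr (_ + _); first by rewrite addrC.
  by rewrite addrC.
Qed.
Lemma cplxf_scale1 : left_id 1 cplxf_scale.
Proof.
by move=> X; apply: cplxfP; rewrite /= scale1r scale0r ?subr0 ?add0r.
Qed.
Lemma cplxf_scaleDr : right_distributive cplxf_scale +%R.
Proof.
move=> c X Y; apply: cplxfP; rewrite /= !scalerDr ?opprD;
  by rewrite addrACA.
Qed.
Lemma cplxf_scaleDl X : {morph cplxf_scale^~ X : c d / c + d}.
Proof.
move=> [a b] [c d]; apply: cplxfP; rewrite /= !scalerDl ?opprD;
  by rewrite addrACA.
Qed.

HB.instance Definition _ := GRing.Zmodule_isLmodule.Build R[i] AC
  cplxf_scaleA cplxf_scale1 cplxf_scaleDr cplxf_scaleDl.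

Lemma cplxf_scaleE (c : R[i]) (X : AC) : c *: X =
  Cplxf (Re c *: cre X - Im c *: cim X) (Im c *: cre X + Re c *: cim X).
Proof. by []. Qed.

Lemma cplxfE (x y : A) : Cplxf x y = Cplxf x 0 + 'i *: Cplxf y 0.
Proof.
by apply: cplxfP; rewrite /= ?scaler0 ?scale0r ?scale1r ?subr0 !(addr0, add0r).
Qed.

Lemma cplxf_vect_iso : Vector.axiom (dim A) AC.
Proof.
exists (fun X => \row_j (v2r (cre X) 0 j +i* v2r (cim X) 0 j)).
- move=> c X Y; apply/rowP=> j; rewrite !mxE /= !linearD !linearN !linearZ /=.
  by rewrite !mxE; case: c => a b; simpc; rewrite [b * _ + _]addrC.
- exists (fun u : 'rV_(dim A) =>
    Cplxf (r2v (\row_j Re (u 0 j))) (r2v (\row_j Im (u 0 j)))).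
  + by move=> X; apply: cplxfP; rewrite /= -[RHS]v2rK; congr r2v;
      apply/rowP=> j; rewrite !mxE.
  + by move=> u; apply/rowP=> j; rewrite !mxE /= !r2vK !mxE; case: (u 0 j).
Qed.

HB.instance Definition _ := Lmodule_hasFinDim.Build R[i] AC cplxf_vect_iso.

Definition cplxf_conj (X : AC) : AC := Cplxf (cre X) (- cim X).

Lemma cplxf_conjK : involutive cplxf_conj.
Proof. by move=> X; apply: cplxfP; rewrite //= opprK. Qed.

Lemma cplxf_conjD : {morph cplxf_conj : X Y / X + Y}.
Proof. by move=> X Y; apply: cplxfP; rewrite //= opprD. Qed.

Lemma cplxf_conjZ c X : cplxf_conj (c *: X) = c^* *: cplxf_conj X.
Proof.
case: c => a b; apply: cplxfP; rewrite /= !scaleNr !scalerN ?opprK //.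
by rewrite opprD.
Qed.

(* As conjugation is semilinear, the set of conjugates of elements of q is
   again a subspace; see [conj_vspaceP]. *)
Definition conj_vspace (q : {vspace AC}) : {vspace AC} :=
  <<map cplxf_conj (vbasis q)>>%VS.

Lemma conj_span (s : seq AC) X :
  X \in <<s>>%VS -> cplxf_conj X \in <<map cplxf_conj s>>%VS.
Proof.
elim: s X => [|Y s IHs] X /=.
  rewrite span_nil memv0 => /eqP ->.
  suff ->: cplxf_conj 0 = 0 by exact: mem0v.
  by apply: cplxfP; rewrite //= oppr0.
rewrite !span_cons => /memv_addP [_ /vlineP [c ->] [Z Zs ->]].
rewrite cplxf_conjD cplxf_conjZ memv_add ?IHs //.
by rewrite rpredZ // memv_line.
Qed.

Lemma conj_vspaceP (q : {vspace AC}) X :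
  reflect (exists2 Y, Y \in q & X = cplxf_conj Y) (X \in conj_vspace q).
Proof.
have eq_q : <<vbasis q>>%VS = q := span_basis (vbasisP q).
apply: (iffP idP) => [Xq | [Y Yq ->]]; last first.
  by apply: conj_span; rewrite eq_q.
exists (cplxf_conj X); last by rewrite cplxf_conjK.
by move/conj_span: Xq; rewrite -map_comp (eq_map cplxf_conjK) map_id eq_q.
Qed.

Lemma cplxf_ext_linear (g : A -> AC) :
  (forall (r : R) x y, g (r *: x + y) = r%:C *: g x + g y) ->
  linear (fun X => g (cre X) + 'i *: g (cim X)).
Proof.
move=> g_lin.
have g0 : g 0 = 0.
  have := g_lin 1 0 0; rewrite !scale1r addr0 => /eqP.
  by rewrite -subr_eq subrr eq_sym => /eqP.
have gD x y : g (x + y) = g x + g y.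
  by have := g_lin 1 x y; rewrite !scale1r.
have gZ r x : g (r *: x) = r%:C *: g x.
  by have := g_lin r x 0; rewrite g0 !addr0.
have gN x : g (- x) = - g x.
  by rewrite -scaleN1r gZ rmorphN1 scaleN1r.
move=> c X Y; rewrite /= !gD gN !gZ !scalerDr !scalerA.
rewrite addrACA; congr (_ + _).
rewrite addrACA -scaleNr -!scalerDl; congr (_ *: _ + _ *: _);
  by case: c => a b; simpc.
Qed.

(* C-linear extension of an R-linear map. *)
Section LinearExtension.

Variable f : {linear A -> A}.

Definition cplxf_lin (X : AC) : AC := Cplxf (f (cre X)) (f (cim X)).

Lemma cplxf_lin_is_linear : linear cplxf_lin.
Proof.
by move=> c X Y; apply: cplxfP; rewrite /= !linearD ?linearN !linearZ.
Qed.

HB.instance Definition _ :=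
  GRing.isLinear.Build R[i] AC AC *:%R cplxf_lin cplxf_lin_is_linear.

Lemma cplxf_linE x : cplxf_lin (Cplxf x 0) = Cplxf (f x) 0.
Proof. by apply: cplxfP; rewrite //= linear0. Qed.

End LinearExtension.

(* C-trilinear extension of an R-trilinear map: expand
   f (x + ix') (y + iy') (z + iz') by multilinearity. *)
Section TrilinearExtension.

Variable f : trilinear A.

Definition cplxf_tri_fun (X Y Z : AC) : AC :=
  Cplxf
    (f (cre X) (cre Y) (cre Z) - f (cre X) (cim Y) (cim Z)
     - f (cim X) (cre Y) (cim Z) - f (cim X) (cim Y) (cre Z))
    (f (cim X) (cre Y) (cre Z) + f (cre X) (cim Y) (cre Z)
     + f (cre X) (cre Y) (cim Z) - f (cim X) (cim Y) (cim Z)).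

Lemma cplxf_tri_linear1 Y Z : linear (fun X => cplxf_tri_fun X Y Z).
Proof.
pose g x := Cplxf (f x (cre Y) (cre Z) - f x (cim Y) (cim Z))
                  (f x (cim Y) (cre Z) + f x (cre Y) (cim Z)).
have gE X : cplxf_tri_fun X Y Z = g (cre X) + 'i *: g (cim X).
  apply: cplxfP; rewrite /= scale0r scale1r ?add0r ?sub0r ?addr0.
    by rewrite opprD -!addrA; congr (_ + (_ + _)); rewrite addrC.
  by rewrite -!addrA addrCA; congr (_ + _); rewrite addrCA.
move=> c X X'; rewrite !gE; apply: cplxf_ext_linear => r x y.
apply: cplxfP; rewrite /= !(tri_linear1 f) scale0r ?subr0 ?add0r.
  by rewrite scalerBr opprD addrACA.
by rewrite scalerDr addrACA.
Qed.

Lemma cplxf_tri_linear2 X Z : linear (fun Y => cplxf_tri_fun X Y Z).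
Proof.
pose g y := Cplxf (f (cre X) y (cre Z) - f (cim X) y (cim Z))
                  (f (cim X) y (cre Z) + f (cre X) y (cim Z)).
have gE Y : cplxf_tri_fun X Y Z = g (cre Y) + 'i *: g (cim Y).
  apply: cplxfP; rewrite /= scale0r scale1r ?add0r ?sub0r ?addr0.
    by rewrite opprD -!addrA; congr (_ + _); rewrite addrCA; congr (_ + _);
      rewrite addrC.
  by rewrite -!addrA; congr (_ + _); rewrite addrCA.
move=> c Y Y'; rewrite !gE; apply: cplxf_ext_linear => r x y.
apply: cplxfP; rewrite /= !(tri_linear2 f) scale0r ?subr0 ?add0r.
  by rewrite scalerBr opprD addrACA.
by rewrite scalerDr addrACA.
Qed.

Lemma cplxf_tri_linear3 X Y : linear (fun Z => cplxf_tri_fun X Y Z).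
Proof.
pose g z := Cplxf (f (cre X) (cre Y) z - f (cim X) (cim Y) z)
                  (f (cim X) (cre Y) z + f (cre X) (cim Y) z).
have gE Z : cplxf_tri_fun X Y Z = g (cre Z) + 'i *: g (cim Z).
  apply: cplxfP; rewrite /= scale0r scale1r ?add0r ?sub0r ?addr0.
    by rewrite opprD -!addrA; congr (_ + _); rewrite addrC -addrA addrCA.
  by rewrite -!addrA.
move=> c Z Z'; rewrite !gE; apply: cplxf_ext_linear => r x y.
apply: cplxfP; rewrite /= !(tri_linear3 f) scale0r ?subr0 ?add0r.
  by rewrite scalerBr opprD addrACA.
by rewrite scalerDr addrACA.
Qed.

Definition cplxf_tri : trilinear AC :=
  Trilinear cplxf_tri_linear1 cplxf_tri_linear2 cplxf_tri_linear3.

Lemma cplxf_triE x y z :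
  cplxf_tri (Cplxf x 0) (Cplxf y 0) (Cplxf z 0) = Cplxf (f x y z) 0.
Proof.
have f1 u v : f 0 u v = 0.
  by have := tri_linear1 f u v (-1) 0 0; rewrite !scaleN1r !addNr.
have f2 u v : f u 0 v = 0.
  by have := tri_linear2 f u v (-1) 0 0; rewrite !scaleN1r !addNr.
have f3 u v : f u v 0 = 0.
  by have := tri_linear3 f u v (-1) 0 0; rewrite !scaleN1r !addNr.
by apply: cplxfP; rewrite /= ?(f1, f2, f3) ?subr0 ?addr0.
Qed.

End TrilinearExtension.

End Complexification.

(* Main.v *)
(** A complex structure [J] corresponds to the graph
    q = {x - iJx | x in A}, the eigenspace of the complexified [J] for the
    eigenvalue i.  The map cre : q -> A is a bijection exactly when A_C is the
    direct sum of q and its conjugate, and for x, y, z in A the imaginary part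
    of op(x - iJx, y - iJy, z - iJz) is minus [J] of its real part exactly when
    the Nijenhuis identity holds at (x, y, z). *)
From HB Require Import structures.
Require Import Defs.
From mathcomp Require Import all_boot all_order all_algebra.
From mathcomp Require Import reals complex.

Set Implicit Arguments.
Unset Strict Implicit.
Unset Printing Implicit Defensive.

Import GRing.Theory Num.Theory.
Local Open Scope ring_scope.
Local Open Scope complex_scope.

Section TrilinearOpposite.

Variables (K : fieldType) (V : lmodType K) (f : trilinear V).

Lemma linear_funN (g : V -> V) : linear g -> {morph g : x / - x}.
Proof.
move=> g_lin x; pose h : {linear V -> V} :=
  HB.pack g (GRing.isLinear.Build K V V *:%R g g_lin).
exact: (raddfN h).
Qed.

Lemma triN1 x y z : f (- x) y z = - f x y z.
Proof. exact: (linear_funN (tri_linear1 f y z)). Qed.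

Lemma triN2 x y z : f x (- y) z = - f x y z.
Proof. exact: (linear_funN (tri_linear2 f x z)). Qed.

Lemma triN3 x y z : f x y (- z) = - f x y z.
Proof. exact: (linear_funN (tri_linear3 f x y)). Qed.

End TrilinearOpposite.

Section ComplexStructureGraph.

Variables (R : rcfType) (A : vectType R).
Notation AC := (complexification A).
Implicit Types (J alpha : {linear A -> A}) (f nw ne : trilinear A).

(** For an arbitrary [J] this set is only a real subspace, hence a predicate; it is stable under
    multiplication by i exactly when J^2 = -1. *)
Definition in_graph J (X : AC) : bool := cim X == - J (cre X).

Lemma nijenhuis_graphP f J : (forall x, J (J x) = - x) ->
  nijenhuis_identity f J <->
  (forall X Y Z, in_graph J X -> in_graph J Y -> in_graph J Z ->
     in_graph J (cplxf_tri f X Y Z)).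
Proof.
move=> Jsq.
(* Let S1 and S2 be the sums of the values of [f] with [J] applied to one, resp. two, arguments. The
   product has real part f x y z - S2 and imaginary part f (J x) (J y) (J z) - S1, and J^2 = -1
   reduces the right-hand side below to J S2 + S1 - J (f x y z). *)
have key x y z :
  in_graph J (cplxf_tri f (Cplxf x (- J x)) (Cplxf y (- J y))
                          (Cplxf z (- J z)))
  <-> f (J x) (J y) (J z)
    = J (f (J x) (J y) z + f (J x) y (J z) + f x (J y) (J z))
      - J (J (f (J x) y z + f x (J y) z + f x y (J z)))
      + J (J (J (f x y z))).
  rewrite /in_graph /= !(triN1, triN2, triN3) !opprK.
  rewrite !Jsq opprK.
  have -> a b c d : - a - b - c + d = d - (a + b + c) :> A.
    by rewrite addrC -!opprD.
  have -> a b c d : a - b - c - d = a - (d + c + b) :> A.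
    rewrite -[LHS]addrA -[LHS]addrA -!opprD addrA [b + c]addrC.
    by rewrite [_ + d]addrC addrA.
  by rewrite linearB /= opprB subr_eq addrAC; split=> /eqP.
split=> [fJ [x x'] [y y'] [z z'] /eqP/= -> /eqP/= -> /eqP/= -> | fJ x y z].
  exact/key/fJ.
by apply/key; apply: fJ; rewrite /in_graph.
Qed.

(** The clauses match one by one: [alpha] sends x - iJx to alpha x - i alpha (J x), which is on the
    graph iff alpha (J x) = J (alpha x). *)
Lemma subalgebra_graphP nw ne alpha J (q : {vspace AC}) :
    (forall x, J (J x) = - x) -> (forall X, (X \in q) = in_graph J X) ->
  is_subalgebra (cplxf_tri nw) (cplxf_tri ne) (cplxf_lin alpha) q <->
  is_nijenhuis nw ne alpha J.
Proof.
move=> Jsq qE; split=> [[q_nw q_ne q_alpha] | [J_alpha J_nw J_ne]].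
  split.
  - move=> x; have := q_alpha (Cplxf x (- J x)).
    rewrite !qE /in_graph eqxx /= linearN eqr_opp.
    by move=> /(_ isT) /eqP.
  - apply/nijenhuis_graphP=> // X Y Z; rewrite -!qE; exact: q_nw.
  - apply/nijenhuis_graphP=> // X Y Z; rewrite -!qE; exact: q_ne.
split.
- move=> X Y Z; rewrite !qE; exact: (proj1 (nijenhuis_graphP _ Jsq) J_nw).
- move=> X Y Z; rewrite !qE; exact: (proj1 (nijenhuis_graphP _ Jsq) J_ne).
- by move=> X; rewrite !qE /in_graph /= J_alpha => /eqP ->; rewrite linearN.
Qed.

Lemma graph_vspace J : (forall x, J (J x) = - x) ->
  exists q : {vspace AC}, forall X, (X \in q) = in_graph J X.
Proof.
(* As a kernel, the eigenspace is a complex subspace. For X = x + iy the eigenvalue equation reads J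
   x = -y and J y = x; the second follows from the first by J^2 = -1. *)
move=> Jsq; pose h (X : AC) := cplxf_lin J X - 'i *: X.
have h_lin : linear h.
  move=> c X Y; rewrite /h linearP scalerDr scalerBr !scalerA mulrC.
  by rewrite opprD addrACA.
pose hL : {linear AC -> AC} :=
  HB.pack h (GRing.isLinear.Build R[i] AC AC *:%R h h_lin).
exists (lker (linfun hL)) => X.
rewrite memv_ker lfunE /= /h subr_eq0 /in_graph.
apply/eqP/eqP=> [XJ | cimX].
  have /= := congr1 (@cre _ _) XJ.
  by rewrite scale0r scale1r sub0r => ->; rewrite opprK.
apply: cplxfP; rewrite /= scale0r scale1r ?addr0 ?sub0r cimX ?opprK //.
by rewrite linearN Jsq opprK.
Qed.

Lemma graph_decomposition J (q : {vspace AC}) :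
    (forall x, J (J x) = - x) -> (forall X, (X \in q) = in_graph J X) ->
  (q + conj_vspace q)%VS = fullv /\ directv (q + conj_vspace q).
Proof.
move=> Jsq qE; split.
  apply/eqP; rewrite eqEsubv subvf /=; apply/subvP=> -[x y] _.
  (* Solution of u + v = x and J v - J u = y. *)
  pose u := 2^-1 *: (x + J y); pose v := 2^-1 *: (x - J y).
  have half a : 2^-1 *: (a + a) = a :> A.
    by rewrite -mulr2n -scaler_nat scalerA mulVf ?scale1r ?pnatr_eq0.
  have -> : Cplxf x y = Cplxf u (- J u) + cplxf_conj (Cplxf v (- J v)).
    apply: cplxfP; rewrite /= /u /v.
      by rewrite -scalerDr addrACA subrr addr0 half.
    rewrite !linearZ /= linearB linearD /= Jsq !opprK -scalerDr opprB.
    by rewrite addrA subrK half.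
  apply: memv_add; first by rewrite qE /in_graph.
  by apply/conj_vspaceP; exists (Cplxf v (- J v)); rewrite ?qE /in_graph.
apply/directv_addP/eqP; rewrite -subv0; apply/subvP=> X.
rewrite memv_cap memv0 => /andP[]; rewrite qE => /eqP XJ.
case/conj_vspaceP=> Y; rewrite qE => /eqP YJ XY.
(* The conjugate of q is the graph of the opposite sign, so [cim X] vanishes; then so does J (cre
   X), and J is injective. *)
have : cim X == - cim X by rewrite {1}XY /= YJ XJ XY.
rewrite -addr_eq0 -mulr2n -scaler_nat scaler_eq0 pnatr_eq0 /= => /eqP X0.
apply/eqP/cplxfP; last by rewrite X0.
rewrite -[LHS]opprK -(Jsq (cre X)) -[J (cre X)]opprK -XJ X0.
by rewrite !(oppr0, linear0).
Qed.

Lemma decomposition_graph (q : {vspace AC}) :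
    (q + conj_vspace q)%VS = fullv -> directv (q + conj_vspace q) ->
  exists2 J : {linear A -> A},
    (forall x, J (J x) = - x) & (forall X, (X \in q) = in_graph J X).
Proof.
move=> q_full q_dir.
have cap0 : (q :&: conj_vspace q)%VS = 0%VS by apply/directv_addP.
(* A purely imaginary X is the conjugate of -X, so it lies in both summands. *)
have cre_inj X : X \in q -> cre X = 0 -> X = 0.
  move=> Xq X0; apply/eqP; rewrite -memv0 -cap0 memv_cap Xq.
  apply/conj_vspaceP; exists (- X); rewrite ?rpredN //.
  by apply: cplxfP; rewrite /= ?opprK // X0 oppr0.
pose P := daddv_pi q (conj_vspace q).
(* Write x = X + conj Y with X and Y in q. Since x is real, X and Y have the same imaginary part, so
   X + Y is an element of q with real part x and imaginary part 2 [cim X], which must be -J x. *)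
pose h (x : A) : A := - (cim (P (Cplxf x 0)) *+ 2).
have h_lin : linear h.
  move=> r x y; rewrite /h.
  have -> : Cplxf (r *: x + y) 0 = r%:C *: Cplxf x 0 + Cplxf y 0 :> AC.
    by apply: cplxfP; rewrite /= !(scaler0, scale0r, subr0, addr0).
  by rewrite linearP /= scale0r add0r mulrnDl opprD scalerN scalerMnr.
have [J JE] : exists J : {linear A -> A}, J =1 h.
  by exists (HB.pack_for {linear A -> A} h
    (GRing.isLinear.Build R A A *:%R h h_lin)).
have graph_q x : Cplxf x (- J x) \in q.
  pose X := P (Cplxf x 0).
  pose Z := daddv_pi (conj_vspace q) q (Cplxf x 0).
  have XZ : X + Z = Cplxf x 0 by apply: daddv_pi_add; rewrite ?q_full ?memvf.
  have Xq : X \in q by exact: memv_pi.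
  have /conj_vspaceP[Y Yq ZE] : Z \in conj_vspace q by exact: memv_pi.
  suff -> : Cplxf x (- J x) = X + Y by exact: rpredD.
  move: XZ; rewrite ZE => XZ; have /= xE := congr1 (@cre _ _) XZ.
  have /= /eqP := congr1 (@cim _ _) XZ; rewrite subr_eq0 => /eqP yE.
  by apply: cplxfP; rewrite /= ?xE // JE /h opprK -yE mulr2n.
have qE X : (X \in q) = in_graph J X.
  apply/idP/idP=> [Xq | /eqP XJ]; last first.
    by have := graph_q (cre X); rewrite -XJ; case: (X).
  have /cre_inj : X - Cplxf (cre X) (- J (cre X)) \in q by exact: rpredB.
  move=> /(_ (subrr _)) /(congr1 (@cim _ _)) /= /eqP.
  by rewrite subr_eq0.
exists J => // x.
(* J^2 = -1 expresses the stability of q under i: i(x - iJx) = Jx + ix is again on the graph. *)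
have : 'i *: Cplxf x (- J x) \in q by exact: rpredZ.
rewrite qE /in_graph /= !(scale0r, scale1r, sub0r, addr0, opprK) => /eqP xJ.
by rewrite {2}xJ opprK.
Qed.

End ComplexStructureGraph.

Theorem theorem4p12 (R : realType) (A : vectType R)
    (nw ne : trilinear A) (alpha : {linear A -> A}) :
  is_hom_L_dendriform3 nw ne alpha ->
  (exists J : {linear A -> A}, is_complex_structure nw ne alpha J) <->
  (exists q : {vspace complexification A},
     [/\ is_subalgebra (cplxf_tri nw) (cplxf_tri ne) (cplxf_lin alpha) q,
         (q + conj_vspace q)%VS = fullv &
         directv (q + conj_vspace q)]).
Proof.
move=> _; split=> [[J [Jsq J_nij]] | [q [q_sub q_full q_dir]]].
  have [q qE] := graph_vspace Jsq; exists q.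
  have [q_full q_dir] := graph_decomposition Jsq qE.
  by split=> //; apply/(subalgebra_graphP _ _ _ Jsq qE).
have [J Jsq qE] := decomposition_graph q_full q_dir.
by exists J; split=> //; apply/(subalgebra_graphP _ _ _ Jsq qE).
Qed.
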